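(* Let $E=\{1,\ldots,m\}$, let $\mathcal F$ be a nonempty family of subsets of $E$ all of the same cardinality $s$, and let $I=\{X: X\subseteq S \text{ for some } S\in\mathcal F\}$. The following statements are equivalent: (i) $(E,I)$ is a matroid, i.e., for all $S_1,S_2\in\mathcal F$ and every $i\in S_1\setminus S_2$ there exists $j\in S_2\setminus S_1$ with $(S_1\setminus\{i\})\cup\{j\}\in\mathcal F$. (ii) For every real $m\times m$ matrix $W=(w(i,j))$ and every permutation $\pi$ of $\{1,\ldots,m\}$ such that $\pi(W)$ is row graded: if the $\pi$-critical base $S^0$ is a minimum weight base with respect to the weights $f^i:=\sum_{j\in S^0}w(i,j)$, $i\in E$ (i.e., $S^0$ minimizes $\sum_{j\in S}f^j$ over $S\in\mathcal F$), then $S^0$ is an optimal solution of the QMWB with cost matrix $W$. (iii) For every real $m\times m$ matrix $W$ and every permutation $\pi$ such that $\pi(W)$ is doubly graded, the $\pi$-critical base $S^0$ is an optimal solution of the QMWB with cost matrix $W$, and moreover the natural lower bound $\bar L$ equals the optimal objective function value of this QMWB.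
   Context: QMWB with cost matrix $W$: minimize $\Pi(S)=\sum_{i\in S}\sum_{j\in S}w(i,j)$ over $S\in\mathcal F$. For each $i\in E$, let $f^i$ (in (iii)) denote the optimal value of $\min_{S\in\mathcal F}\sum_{j\in S}w(i,j)$; the natural lower bound $\bar L$ is the optimal value of $\min_{S\in\mathcal F}\sum_{j\in S}f^j$. An $m\times m$ matrix $W$ is row graded if $w(i,1)\leq\cdots\leq w(i,m)$ for all $i$, and doubly graded if both $W$ and $W^T$ are row graded. For a permutation $\pi$, $\pi(W)$ is the matrix with $(i,j)$-entry $w(\pi^{-1}(i),\pi^{-1}(j))$. The $\pi$-critical base is the base $\{i_1,\ldots,i_s\}\in\mathcal F$ for which $\{\pi(i_1),\ldots,\pi(i_s)\}$ is lexicographically smallest (comparing sets as increasingly sorted sequences) among all $\{\pi(j_1),\ldots,\pi(j_s)\}$ with $\{j_1,\ldots,j_s\}\in\mathcal F$. *)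

(* Defs.v *)
From HB Require Import structures.
From mathcomp Require Import all_boot all_order all_algebra all_fingroup.
From mathcomp Require Import reals.

Set Implicit Arguments.
Unset Strict Implicit.
Unset Printing Implicit Defensive.

Import Order.TTheory GRing.Theory Num.Theory.
Local Open Scope ring_scope.

(* The ground set {1, ..., m} is 'I_m, i.e. it is numbered from 0. *)

Section SetSystems.
Variable m : nat.
Implicit Types (F I : {set {set 'I_m}}) (S X Y : {set 'I_m}).

Definition indep F : {set {set 'I_m}} :=
  [set X : {set 'I_m} | [exists S in F, X \subset S]].

Definition matroid I : Prop :=
  [/\ set0 \in I,
      forall X Y, Y \in I -> X \subset Y -> X \in I
    & forall X Y, X \in I -> Y \in I -> (#|X| < #|Y|)%N ->
        exists2 y, y \in Y :\: X & y |: X \in I].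

Definition base_exchange F : Prop :=
  forall S1 S2, S1 \in F -> S2 \in F ->
  forall i, i \in S1 :\: S2 ->
  exists2 j, j \in S2 :\: S1 & j |: (S1 :\ i) \in F.

Definition sorted_image (pi : {perm 'I_m}) S : seq nat :=
  sort leq [seq (pi i : nat) | i in S].

Definition critical_base F (pi : {perm 'I_m}) S0 : Prop :=
  S0 \in F /\
  forall S, S \in F ->
    ((sorted_image pi S0 : seqlexi nat) <= (sorted_image pi S : seqlexi nat))%O.

Lemma sorted_image_inj (pi : {perm 'I_m}) : injective (sorted_image pi).
Proof.
move=> S T eqST; apply/setP => i.
have mem_si U : (pi i : nat) \in sorted_image pi U = (i \in U).
  rewrite mem_sort; apply/mapP/idP => [[j jU /val_inj/perm_inj ->]|iU].
    by rewrite mem_enum in jU.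
  by exists i; rewrite ?mem_enum.
by rewrite -!mem_si eqST.
Qed.

Lemma critical_base_exists F (pi : {perm 'I_m}) :
  F != set0 -> exists! S0, critical_base F pi S0.
Proof.
case/set0Pn => S SF.
case: (@Order.TotalTheory.arg_minP _ (seqlexi nat) _ S (mem F)
         (sorted_image pi) SF) => S0 S0F S0min.
exists S0; split=> [|S1 [S1F S1min]]; first by split.
apply: (@sorted_image_inj pi); apply: (@le_anti _ (seqlexi nat)).
by rewrite S0min // S1min.
Qed.

End SetSystems.

Section Costs.
Variables (R : realType) (m : nat).
Implicit Types (F : {set {set 'I_m}}) (S : {set 'I_m}) (W : 'M[R]_m).
Implicit Types (c : {set 'I_m} -> R).

Definition minimizer F c S0 : Prop :=
  S0 \in F /\ forall S, S \in F -> c S0 <= c S.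

(* Only meaningful for F != set0; see opt_valueP. *)
Definition opt_value F c : R :=
  c [arg min_(S < odflt set0 [pick S in F] | S \in F) c S]%O.

Lemma opt_valueP F c : F != set0 ->
  (exists2 S, S \in F & c S = opt_value F c) /\
  (forall S, S \in F -> opt_value F c <= c S).
Proof.
case/set0Pn => S SF; rewrite /opt_value.
have inF : odflt set0 [pick S in F] \in F.
  by case: pickP => [T TF //|/(_ S)]; rewrite SF.
by case: arg_minP => // T TF Tmin; split; first by exists T.
Qed.

Definition weight (f : 'I_m -> R) S : R := \sum_(j in S) f j.

Definition qcost W S : R := \sum_(i in S) \sum_(j in S) W i j.

Definition qmwb_optimal F W S0 : Prop := minimizer F (qcost W) S0.

Definition natural_lower_bound F W : R :=
  opt_value F (weight (fun i => opt_value F (weight (W i)))).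

Definition row_graded W : Prop :=
  forall i j k : 'I_m, (j <= k)%N -> W i j <= W i k.

Definition doubly_graded W : Prop := row_graded W /\ row_graded W^T.

Definition permute_mx (pi : {perm 'I_m}) W : 'M[R]_m :=
  \matrix_(i, j) W (pi^-1%g i) (pi^-1%g j).

End Costs.

(* Main.v *)
Require Import Defs.
From HB Require Import structures.
From mathcomp Require Import all_boot all_order all_algebra all_fingroup.
From mathcomp Require Import reals.

Set Implicit Arguments.
Unset Strict Implicit.
Unset Printing Implicit Defensive.

Import Order.TTheory GRing.Theory Num.Theory.
Local Open Scope ring_scope.

(** Every condition is equivalent to the optimality of the greedy algorithm:
    for all weights that increase along [pi], the [pi]-critical base has minimum
    weight.  Under this property the critical base minimizes every row of a
    row graded matrix, so
    [qcost W S >= sum_(i in S) f^i >= sum_(i in S0) f^i = qcost W S0],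
    where the second inequality is the hypothesis of (ii), and in (iii) follows
    by applying the property again to [f], which increases along [pi].
    Conversely, the matrices [W i j = f j] and [W i j = f i + f j] turn the
    quadratic problems of (ii) and (iii) into the linear one with weights [f]. *)

(** The entries below [e] form a common prefix. Next comes [e] in [a], and in [b] a larger entry,
    which exists because the sizes agree. *)
Lemma ltxi_first_difference (a b : seq nat) (e : nat) :
  sorted ltn a -> sorted ltn b -> size a = size b ->
  e \in a -> e \notin b ->
  (forall x, (x < e)%N -> (x \in a) = (x \in b)) ->
  ((a : seqlexi nat) < (b : seqlexi nat))%O.
Proof.
elim: a b => [|x a IHa] [|y b] //= sa sb [eq_size] ea eb agree.
have lt_a : forall z, z \in a -> (x < z)%N.
  by apply/allP; apply: order_path_min sa; apply: ltn_trans.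
have lt_b : forall z, z \in b -> (y < z)%N.
  by apply/allP; apply: order_path_min sb; apply: ltn_trans.
have le_xe : (x <= e)%N.
  by move: ea; rewrite inE => /predU1P [->|/lt_a /ltnW].
rewrite ltxi_cons !leEnat; case: (ltngtP x y) => //= [lt_yx|eq_xy].
  (* Here [y] lies below [e], so [agree] puts it in [x :: a], whose least entry is [x]. *)
  have := agree y (leq_trans lt_yx le_xe).
  rewrite !inE eqxx /= => /predU1P [eq_yx|/lt_a].
    by rewrite eq_yx ltnn in lt_yx.
  by rewrite ltnNge (ltnW lt_yx).
subst y; move: eb; rewrite inE negb_or => /andP [ne_ex eb].
apply: IHa => //; [exact: path_sorted sa | exact: path_sorted sb | |].
  by move: ea; rewrite inE (negPf ne_ex).
move=> z lt_ze; have := agree z lt_ze; rewrite !inE.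
case: eqVneq => [->|//] _.
by apply/idP/idP => [/lt_a|/lt_b]; rewrite ltnn.
Qed.

(** * Lexicographic order of bases along a permutation *)

Section SortedImages.
Variable m : nat.
Implicit Types (F : {set {set 'I_m}}) (S X : {set 'I_m}) (pi : {perm 'I_m}).

Lemma mem_sorted_image pi S i : ((pi i : nat) \in sorted_image pi S) = (i \in S).
Proof.
rewrite mem_sort; apply/mapP/idP => [[j jS /val_inj/perm_inj ->]|iS].
  by rewrite mem_enum in jS.
by exists i; rewrite ?mem_enum.
Qed.

Lemma sorted_image_sorted pi S : sorted ltn (sorted_image pi S).
Proof.
rewrite ltn_sorted_uniq_leq sort_uniq (sort_sorted leq_total) andbT.
by rewrite map_inj_uniq ?enum_uniq // => i j /val_inj /perm_inj.
Qed.

Lemma size_sorted_image pi S : size (sorted_image pi S) = #|S|.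
Proof. by rewrite size_sort size_map cardE. Qed.

Lemma sorted_image_lt pi S1 S2 e :
  #|S1| = #|S2| -> e \in S1 -> e \notin S2 ->
  (forall i, (pi i < pi e)%N -> (i \in S1) = (i \in S2)) ->
  ((sorted_image pi S1 : seqlexi nat) < (sorted_image pi S2 : seqlexi nat))%O.
Proof.
move=> eq_card e1 e2 agree; apply: (@ltxi_first_difference _ _ (pi e));
  rewrite ?sorted_image_sorted ?size_sorted_image ?mem_sorted_image //.
move=> x lt_xe; have lt_xm := ltn_trans lt_xe (ltn_ord (pi e)).
have -> : x = pi (pi^-1%g (Ordinal lt_xm)) by rewrite permKV.
by rewrite !mem_sorted_image agree // permKV.
Qed.

(** Let [e] come first in [X :\: S0]. All elements before [e] that lie in [S1] or not agree with
    [S0] once they are known to be in [X], so [S1] would beat [S0] at [e]. *)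
Lemma critical_base_initial F pi S0 S1 X :
  critical_base F pi S0 -> S1 \in F -> #|S1| = #|S0| -> X \subset S1 ->
  (forall i j, (pi i < pi j)%N -> j \in X -> i \in X) ->
  X \subset S0.
Proof.
move=> [_ S0min] S1F eq_card /subsetP sX1 initX.
apply/subsetP => x xX; apply/negPn/negP => xS0.
have Dx : x \in X :\: S0 by rewrite inE xS0.
case: (@arg_minnP _ x (mem (X :\: S0)) (fun i => nat_of_ord (pi i)) Dx) => e.
case/setDP => eX eS0 emin.
have := S0min S1 S1F; rewrite leNgt (@sorted_image_lt pi S1 S0 e) //; first exact: sX1.
move=> i lt_ie; have iX := initX _ _ lt_ie eX; rewrite (sX1 _ iX); apply/esym.
apply/negPn/negP => iS0; have := emin i; rewrite /= inE iS0 iX => /(_ isT).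
by rewrite leqNgt lt_ie.
Qed.

(** The permutation sends [i] to its rank in an enumeration sorted by [g]; ties are broken
    arbitrarily. *)
Lemma exists_sorting_perm (g : 'I_m -> nat) :
  exists pi : {perm 'I_m}, forall i j, (g i < g j)%N -> (pi i < pi j)%N.
Proof.
pose r := [rel i j | (g i <= g j)%N]; pose s := sort r (enum 'I_m).
have r_tr : transitive r by move=> j i k; apply: leq_trans.
have r_refl : reflexive r by move=> i; apply: leqnn.
have s_sorted : sorted r s by apply: sort_sorted => i j; apply: leq_total.
have mem_s i : i \in s by rewrite mem_sort mem_enum.
have idx_lt i : (index i s < m)%N.
  by rewrite -[X in (_ < X)%N](size_enum_ord m) -(size_sort r) index_mem.
have idx_inj : injective (fun i => Ordinal (idx_lt i)).
  by move=> i j [] /index_inj ->.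
exists (perm idx_inj) => i j; rewrite !permE /=; apply: contraTT.
by rewrite -!leqNgt; apply: (sorted_leq_index r_tr r_refl s_sorted).
Qed.

End SortedImages.

(** Augment [S1 :\ i] from [S2]. The new element is not [i], and the resulting set has [s] elements,
    so it is a base. *)
Lemma matroid_base_exchange (m s : nat) (F : {set {set 'I_m}}) :
  (forall S, S \in F -> #|S| = s) -> matroid (indep F) -> base_exchange F.
Proof.
move=> F_card [_ _ augment] S1 S2 S1F S2F i /setDP [i1 i2].
have ltS12 : (#|S1 :\ i| < #|S2|)%N.
  by rewrite (F_card _ S2F) -(F_card _ S1F) [X in (_ < X)%N](cardsD1 i) i1.
have I1 : S1 :\ i \in indep F.
  by rewrite inE; apply/exists_inP; exists S1; rewrite ?subD1set.
have I2 : S2 \in indep F by rewrite inE; apply/exists_inP; exists S2.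
have [j /setDP [j2 j1]] := augment _ _ I1 I2 ltS12.
rewrite inE => /exists_inP [S SF sub_S].
have ne_ji : j != i by apply: contraNneq i2 => <-.
exists j.
  by rewrite inE j2 andbT; move: j1; rewrite !inE ne_ji.
suff -> : j |: S1 :\ i = S by [].
apply/eqP; rewrite eqEcard sub_S cardsU1 j1 (F_card _ SF) -(F_card _ S1F).
by rewrite (cardsD1 i S1) i1 /=.
Qed.

Definition greedy_optimal (R : realType) (m : nat) (F : {set {set 'I_m}}) : Prop :=
  forall (f : 'I_m -> R) (pi : {perm 'I_m}) (S0 : {set 'I_m}),
    (forall i j, (pi i <= pi j)%N -> f i <= f j) ->
    critical_base F pi S0 -> minimizer F (weight f) S0.

(** * Matroids and the greedy algorithm *)

Section Greedy.
Variables (R : realType) (m s : nat) (F : {set {set 'I_m}}).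
Hypothesis F_nonempty : F != set0.
Hypothesis F_card : forall S, S \in F -> #|S| = s.
Implicit Types (S : {set 'I_m}) (W : 'M[R]_m) (pi : {perm 'I_m}) (f : 'I_m -> R).

Lemma weight_exchange f S i j : i \in S -> j \notin S ->
  weight f (j |: S :\ i) = weight f S - f i + f j.
Proof.
move=> iS jS; have jSi : j \notin S :\ i by rewrite !inE (negPf jS) andbF.
by rewrite /weight big_setU1 //= (big_setD1 i iS) /= addrC [f i + _]addrC addrK.
Qed.

(* Among the minimum weight bases, let [S] be one that meets [S0] most, and let
   [i] come last in the symmetric difference.  An exchange at [i] brings [S]
   closer to [S0] if [i] lies in [S], and makes [S0] lexicographically smaller
   if [i] lies in [S0]. *)
Lemma base_exchange_greedy : base_exchange F -> greedy_optimal R F.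
Proof.
move=> exch f pi S0 fmon [S0F S0min].
have [[T TF Topt] optle] := opt_valueP (weight f) F_nonempty.
pose P S := (S \in F) && (weight f S == opt_value F (weight f)).
have PT : P T by rewrite /P TF Topt eqxx.
case: (arg_maxnP (fun S => #|S :&: S0|) PT) => S /andP [SF /eqP Sopt] Smax.
suff -> : S0 = S by split=> // U UF; rewrite Sopt optle.
have [//|neS] := eqVneq S0 S.
have /set0Pn [x Dx] : (S :\: S0) :|: (S0 :\: S) != set0.
  by apply: contraNneq neS => /eqP; rewrite setU_eq0 !setD_eq0 eqEsubset andbC.
case: (@arg_maxnP _ x (mem ((S :\: S0) :|: (S0 :\: S)))
         (fun i => nat_of_ord (pi i)) Dx) => i.
case/setUP => iD imax.
- have [j jD SjF] := exch _ _ SF S0F i iD.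
  have le_ji : (pi j <= pi i)%N by apply: imax; rewrite /= inE jD orbT.
  case/setDP: iD => iS iS0; case/setDP: jD => jS0 jS.
  (* As [j] precedes [i], the exchange does not increase the weight. *)
  have Pj : P (j |: S :\ i).
    rewrite /P SjF eq_le optle // andbT weight_exchange // -Sopt.
    by rewrite -addrA gerDl addrC subr_le0 fmon.
  have /= := Smax _ Pj; rewrite leqNgt => /negP []; apply: proper_card.
  apply/properP; split.
    apply/subsetP => y /setIP [yS yS0]; rewrite !inE yS yS0 !andbT.
    by apply/orP; right; apply: contraNneq iS0 => <-.
  by exists j; rewrite !inE ?eqxx ?jS0 // (negPf jS).
have [j jD SjF] := exch _ _ S0F SF i iD.
have le_ji : (pi j <= pi i)%N by apply: imax; rewrite /= inE jD.
case/setDP: iD => iS0 iS; case/setDP: jD => jS jS0.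
have ne_ji : j != i by apply: contraNneq iS => <-.
have := S0min _ SjF; rewrite leNgt (@sorted_image_lt _ _ _ _ j) //.
- by rewrite !F_card.
- by rewrite !inE eqxx.
move=> k lt_kj; rewrite !inE.
have -> : (k == j) = false by apply: contraTF lt_kj => /eqP ->; rewrite ltnn.
suff -> : k != i by [].
by apply: contraTneq lt_kj => ->; rewrite -leqNgt.
Qed.

(* List [X] first, then [Y], then the rest, with weight 0 on [X :|: Y] and 1
   elsewhere.  The critical base contains [X]; if [X] had no augmentation from
   [Y], its weight [s - #|X|] would exceed that of a base containing [Y]. *)
Lemma greedy_matroid : greedy_optimal R F -> matroid (indep F).
Proof.
move=> greedy; split.
- by have /set0Pn [S SF] := F_nonempty; rewrite inE; apply/exists_inP; exists S; rewrite ?sub0set.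
- move=> X Y; rewrite !inE => /exists_inP [S SF sYS] sXY.
  by apply/exists_inP; exists S => //; apply: subset_trans sYS.
move=> X Y; rewrite !inE => /exists_inP [S1 S1F sX1] /exists_inP [S2 S2F sY2] ltXY.
pose g (i : 'I_m) := if i \in X then 0%N else if i \in Y then 1%N else 2%N.
have [pi pi_sorts] := exists_sorting_perm g.
pose f (i : 'I_m) : R := (g i == 2%N)%:R.
have fmon i j : (pi i <= pi j)%N -> f i <= f j.
  have [/pi_sorts|le_g _] := ltnP (g j) (g i); first by rewrite ltnNge => /negPf ->.
  rewrite /f ler_nat; move: le_g; rewrite /g.
  by case: (i \in X); case: (i \in Y); case: (j \in X); case: (j \in Y).
have [S0 [crit _]] := critical_base_exists pi F_nonempty.
have [S0F S0opt] := greedy f pi S0 fmon crit.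
have sX0 : X \subset S0.
  apply: (critical_base_initial crit S1F) => //; first by rewrite !F_card.
  move=> i j lt_ij jX; apply: contraTT lt_ij => iX; rewrite -leqNgt ltnW //.
  by apply: pi_sorts; rewrite /g jX (negPf iX); case: ifP.
have weightE S : weight f S = #|S :\: (X :|: Y)|%:R.
  rewrite /weight -sum1_card natr_sum big_mkcond [RHS]big_mkcond /=.
  apply: eq_bigr => i _; rewrite /f /g !inE.
  by case: (i \in S); case: (i \in X); case: (i \in Y).
have [/existsP [y /andP [yD y0]]|noy] := boolP [exists y, (y \in Y :\: X) && (y \in S0)].
  exists y => //; rewrite inE; apply/exists_inP; exists S0 => //.
  by rewrite subUset sub1set y0.
have := S0opt _ S2F; rewrite !weightE ler_nat leqNgt => /negP [].
have -> : S0 :\: (X :|: Y) = S0 :\: X.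
  apply/setP => i; rewrite !inE; case: (boolP (i \in X)) => //= iX.
  case: (boolP (i \in Y)) => //= iY; apply/esym/negbTE.
  by apply: contra noy => i0; apply/existsP; exists i; rewrite inE iX iY.
have le2 : (#|S2 :\: (X :|: Y)| <= #|S2 :\: Y|)%N.
  by apply/subset_leq_card/setDS/subsetUr.
apply: leq_ltn_trans le2 _.
rewrite !cardsD (setIidPr sY2) (setIidPr sX0) (F_card S2F) (F_card S0F).
(* Subtraction is truncated, so strictness also requires [#|X| < s]. *)
apply: ltn_sub2l => //; apply: leq_trans ltXY _.
by rewrite -(F_card S2F) subset_leq_card.
Qed.

(** * From greedy optimality to quadratic costs *)

Lemma permute_row_monotone W pi i :
  row_graded (permute_mx pi W) ->
  forall j k, (pi j <= pi k)%N -> W i j <= W i k.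
Proof. by move=> graded j k /(graded (pi i)); rewrite !mxE !permK. Qed.

Lemma greedy_row_graded : greedy_optimal R F ->
  forall W pi S0, row_graded (permute_mx pi W) -> critical_base F pi S0 ->
  minimizer F (weight (fun i => \sum_(j in S0) W i j)) S0 ->
  qmwb_optimal F W S0.
Proof.
move=> greedy W pi S0 graded crit [S0F S0opt]; split=> // S SF.
(* [qcost W S0] is by definition the weight of [S0] for the row sums over [S0]. *)
apply: le_trans (S0opt S SF) _; apply: ler_sum => i _.
by have [_ ->] := greedy (W i) pi S0 (permute_row_monotone i graded) crit.
Qed.

Lemma opt_value_minimizer (c : {set 'I_m} -> R) S0 :
  minimizer F c S0 -> opt_value F c = c S0.
Proof.
move=> [S0F S0opt]; have [[S SF optE] optle] := opt_valueP c F_nonempty.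
by apply: le_anti; rewrite optle //= -optE S0opt.
Qed.

Lemma greedy_doubly_graded : greedy_optimal R F ->
  forall W pi S0, doubly_graded (permute_mx pi W) -> critical_base F pi S0 ->
  qmwb_optimal F W S0 /\ natural_lower_bound F W = opt_value F (qcost W).
Proof.
move=> greedy W pi S0 [graded gradedT] crit.
pose f i := opt_value F (weight (W i)).
have fE i : f i = \sum_(j in S0) W i j.
  by apply: opt_value_minimizer; apply: greedy crit; apply: permute_row_monotone.
have eq_weight S : weight f S = weight (fun i => \sum_(j in S0) W i j) S.
  by apply: eq_bigr => i _.
(* Grading of the transpose compares rows entry by entry, so the row sums over [S0] increase along
   [pi]. *)
have fopt : minimizer F (weight f) S0.
  apply: greedy crit => i j le_ij; rewrite !fE; apply: ler_sum => k _.
  by have := gradedT (pi k) _ _ le_ij; rewrite !mxE !permK.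
have qopt : qmwb_optimal F W S0.
  apply: greedy_row_graded crit _ => //; case: fopt => S0F S0opt.
  by split=> // S SF; rewrite -!eq_weight S0opt.
split=> //; rewrite /natural_lower_bound (opt_value_minimizer fopt).
by rewrite (opt_value_minimizer qopt) eq_weight.
Qed.

(** * From quadratic costs back to linear weights *)

Lemma qcost_row_constant f S : S \in F ->
  qcost (\matrix_(i, j) f j) S = weight f S *+ s.
Proof.
move=> SF; rewrite /qcost -(F_card SF) -sumr_const.
by apply: eq_bigr => i _; apply: eq_bigr => j _; rewrite mxE.
Qed.

Lemma qcost_sum f S : S \in F ->
  qcost (\matrix_(i, j) (f i + f j)) S = (weight f S *+ s) *+ 2.
Proof.
move=> SF; rewrite mulr2n -{1}(F_card SF) -(qcost_row_constant f SF) -sumrMnl.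
rewrite /qcost -big_split /=; apply: eq_bigr => i _.
rewrite -sumr_const -big_split; apply: eq_bigr => j _.
by rewrite !mxE.
Qed.

Lemma minimizer_weightMn (c : {set 'I_m} -> R) f n S0 : (0 < n)%N ->
  (forall S, S \in F -> c S = weight f S *+ n) ->
  minimizer F c S0 -> minimizer F (weight f) S0.
Proof.
move=> n_gt0 cE [S0F S0opt]; split=> // S SF.
by have := S0opt S SF; rewrite !cE // lerMn2r gtn_eqF.
Qed.

(** Settles the degenerate case, where the factor [s] between quadratic cost and weight cannot be
    cancelled. *)
Lemma minimizer_card0 f S0 : s = 0%N -> S0 \in F -> minimizer F (weight f) S0.
Proof.
move=> s0 S0F; split=> // S SF.
suff -> : S0 = S by [].
by rewrite (cards0_eq (etrans (F_card SF) s0)) (cards0_eq (etrans (F_card S0F) s0)).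
Qed.

Lemma row_graded_greedy :
  (forall W pi S0, row_graded (permute_mx pi W) -> critical_base F pi S0 ->
     minimizer F (weight (fun i => \sum_(j in S0) W i j)) S0 ->
     qmwb_optimal F W S0) ->
  greedy_optimal R F.
Proof.
move=> opt f pi S0 fmon crit; have [S0F _] := crit.
have [s0|s_gt0] := posnP s; first exact: minimizer_card0.
apply: (@minimizer_weightMn (qcost (\matrix_(i, j) f j)) f s) => //.
  by move=> S; apply: qcost_row_constant.
apply: opt crit _ => [i j k le_jk|]; first by rewrite !mxE fmon // !permKV.
split=> // S SF.
(* All the weights [f^i] equal [weight f S0], so every base has the same weight and the hypothesis
   of (ii) holds. *)
have wE T : T \in F ->
    weight (fun i => \sum_(j in S0) (\matrix_(i, j) f j) i j) T = weight f S0 *+ s.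
  move=> TF; rewrite -(F_card TF) -sumr_const; apply: eq_bigr => i _.
  by apply: eq_bigr => j _; rewrite mxE.
by rewrite !wE.
Qed.

Lemma doubly_graded_greedy :
  (forall W pi S0, doubly_graded (permute_mx pi W) -> critical_base F pi S0 ->
     qmwb_optimal F W S0) ->
  greedy_optimal R F.
Proof.
move=> opt f pi S0 fmon crit; have [S0F _] := crit.
have [s0|s_gt0] := posnP s; first exact: minimizer_card0.
apply: (@minimizer_weightMn (qcost (\matrix_(i, j) (f i + f j))) f (s * 2)).
- by rewrite muln_gt0 s_gt0.
- by move=> S SF; rewrite qcost_sum // mulrnA.
apply: opt crit; split=> i j k le_jk; rewrite !mxE.
  by rewrite lerD2l fmon // !permKV.
by rewrite lerD2r fmon // !permKV.
Qed.

End Greedy.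

Theorem theorem11 (R : realType) (m s : nat) (F : {set {set 'I_m}})
    (F_nonempty : F != set0)
    (F_card : forall S : {set 'I_m}, S \in F -> #|S| = s) :
  [<-> (* (i) *)
       matroid (indep F);
       (* (i), in terms of bases *)
       base_exchange F;
       (* (ii) *)
       forall (W : 'M[R]_m) (pi : {perm 'I_m}) (S0 : {set 'I_m}),
         row_graded (permute_mx pi W) ->
         critical_base F pi S0 ->
         minimizer F (weight (fun i : 'I_m => \sum_(j in S0) W i j)) S0 ->
         qmwb_optimal F W S0;
       (* (iii) *)
       forall (W : 'M[R]_m) (pi : {perm 'I_m}) (S0 : {set 'I_m}),
         doubly_graded (permute_mx pi W) ->
         critical_base F pi S0 ->
         qmwb_optimal F W S0 /\
         natural_lower_bound F W = opt_value F (qcost W)].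
Proof.
tfae.
- exact: matroid_base_exchange F_card.
- move=> exch; apply: greedy_row_graded.
  exact: base_exchange_greedy F_nonempty F_card exch.
- move=> opt; apply: greedy_doubly_graded => //.
  exact: row_graded_greedy F_card opt.
- move=> opt; apply: (greedy_matroid F_nonempty F_card (R := R)).
  apply: doubly_graded_greedy F_card _ => W pi S0 graded crit.
  by have [] := opt W pi S0 graded crit.
Qed.
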